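(* Let $X$ be a nonnegative random variable with $X\in L^{p}$ for some $p>1$, and let $X_1,X_2,\ldots$ be independent random variables distributed as $X$. Then for every $\alpha>0$, the empirical fractional generalized cumulative entropy converges almost surely to the fractional generalized cumulative entropy of $X$: $$CE_{\alpha}(\hat F_{n})\to CE_{\alpha}(X)\quad\text{almost surely, as } n\to\infty.$$
   Context: $X$ has support $(0,l)$, $0<l\le\infty$, and cumulative distribution function $F$. The fractional generalized cumulative entropy of $X$ of order $\alpha>0$ is $CE_{\alpha}(X)=\frac{1}{\Gamma(\alpha+1)}\int_{0}^{l}F(x)[-\ln F(x)]^{\alpha}\,dx$, provided the integral is finite. The empirical distribution function of $X_1,\dots,X_n$ is $\hat F_n(x)=\frac1n\sum_{i=1}^n I_{\{X_i\le x\}}$, and the empirical fractional generalized cumulative entropy is $$CE_{\alpha}(\hat F_n)=\frac{1}{\Gamma(\alpha+1)}\int_0^l\hat F_n(x)[-\ln\hat F_n(x)]^{\alpha}\,dx=\frac{1}{\Gamma(\alpha+1)}\sum_{k=1}^{n-1}(X_{k+1:n}-X_{k:n})\,\frac{k}{n}\left[-\ln\frac{k}{n}\right]^{\alpha},$$ where $X_{1:n}\le\cdots\le X_{n:n}$ are the order statistics and the integrand is $0$ where $\hat F_n(x)=0$. *)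

(* Defs.v *)
From mathcomp Require Import all_boot all_order all_algebra.
From mathcomp Require Import all_classical all_reals all_analysis.

Set Implicit Arguments.
Unset Strict Implicit.
Unset Printing Implicit Defensive.

Import Order.TTheory GRing.Theory Num.Theory.
Import numFieldNormedType.Exports.

Local Open Scope classical_set_scope.
Local Open Scope ring_scope.

(* Meaningful for s > 0, where the integral is finite. *)
Definition Gamma (R : realType) (s : R) : R :=
  \int[@lebesgue_measure R]_(t in `]0, +oo[) (t `^ (s - 1) * expR (- t)).

(* Entropy of order a of a distribution function G, integrated over ]0, l[ with
   l possibly +oo.  The integrand is nonnegative, so the integral always makes
   sense in \bar R; it is +oo exactly when the entropy is not finite.
   The integrand vanishes where G x = 0, because ln 0 = 0 and a > 0. *)
Definition CE (R : realType) (l : \bar R) (a : R) (G : R -> R) : \bar R :=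
  ((Gamma (a + 1))^-1%:E *
   \int[@lebesgue_measure R]_(x in [set x : R | 0 < x%:E < l])
     (G x * (- ln (G x)) `^ a)%R%:E)%E.

(* fine only forgets that the library's cdf, which lies in [0, 1], is valued
   in \bar R. *)
Definition distr_fun (d : measure_display) (T : measurableType d)
    (R : realType) (P : probability T R) (X : {RV P >-> R}) (x : R) : R :=
  fine (cdf X x).

(* The sample is indexed from 0: Xs 0, ..., Xs (n - 1) are X_1, ..., X_n. *)
Definition emp_distr_fun (T : Type) (R : realType) (Xs : nat -> T -> R)
    (n : nat) (w : T) (x : R) : R :=
  n%:R^-1 * \sum_(i < n) (Xs i w <= x)%R%:R.

Definition mutually_independent (d : measure_display) (T : measurableType d)
    (R : realType) (P : probability T R) (Xs : nat -> {RV P >-> R}) : Prop :=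
  forall (J : seq nat) (B : nat -> set R), uniq J ->
    (forall i, measurable (B i)) ->
    P (\bigcap_(i in [set` J]) (Xs i @^-1` B i)) =
    (\prod_(i <- J) P (Xs i @^-1` B i))%E.

(* Restricted to measurable sets: pushforwards need not agree elsewhere. *)
Definition same_distribution (d : measure_display) (T : measurableType d)
    (R : realType) (P : probability T R) (X Y : {RV P >-> R}) : Prop :=
  forall A : set R, measurable A -> distribution P X A = distribution P Y A.

(* Main.v *)
(* Write Q_n and q for the empirical and the true tails 1 - F_n and 1 - F, and
   phi u = u * (- ln u) `^ a.  Since phi u <= C * (1 - u) `^ b whenever
   0 < b < 1 and b <= a, the convergence follows by dominated convergence once,
   almost surely, all the Q_n `^ b lie below one integrable function.  Such a
   function exists as soon as q `^ b is integrable: for n = 2 ^ k one has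
   Q_n `^ b <= 2 q `^ b + r_k, where the mean of r_k is controlled by that of Q_n
   when n q <= 1 and by the variance of Q_n when n q > 1, so that the means of
   the r_k sum to at most C q `^ b; by Tonelli sum_k r_k is integrable almost
   surely, and Q_m <= 2 Q_(2 ^ (k + 1)) fills the gaps between powers of two.
   The same use of Tonelli, along n = k ^ 2 with the variance, gives Q_n --> q.

   Markov's inequality makes q `^ b0 integrable for some b0 < 1 because p > 1.
   If b0 <= a take b = b0.  Otherwise a < 1; if the entropy of X is finite then
   q `^ a is integrable and b = a works, and if it is infinite Fatou's lemma
   suffices. *)

Require Import Defs.
From mathcomp Require Import all_boot all_order all_algebra.
From mathcomp Require Import all_classical all_reals all_analysis.
From mathcomp Require Import measurable_realfun zify ring lra.

Set Implicit Arguments.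
Unset Strict Implicit.
Unset Printing Implicit Defensive.

Import Order.TTheory GRing.Theory Num.Theory.
Import numFieldNormedType.Exports.

Local Open Scope classical_set_scope.
Local Open Scope ring_scope.

(** * Elementary facts on powers and logarithms *)

Lemma one_powR {R : realType} (x : R) : 1 `^ x = 1.
Proof. by rewrite powR1. Qed.

(** At a positive limit the power function is differentiable, hence continuous. At 0
    differentiability may fail, so there v n ^ p < e is read off from v n < e ^ (1 / p). *)
Lemma cvg_powR {R : realType} (p : R) (v : nat -> R) (v0 : R) :
  0 < p -> (forall n, 0 <= v n) -> v @ \oo --> v0 ->
  (fun n => v n `^ p) @ \oo --> v0 `^ p.
Proof.
move=> p0 v_ge0 vv0.
have v0_ge0 : 0 <= v0 by apply: (cvgr_to_ge vv0); exact: nearW.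
move: v0_ge0; rewrite le_eqVlt => /predU1P[v0E|v0_gt0].
- rewrite -v0E powR0 ?gt_eqF//; apply/cvgrPdist_lt => e e0.
  have d0 : 0 < e `^ p^-1 by exact: powR_gt0.
  move/cvgrPdist_lt : vv0 => /(_ _ d0); apply: filterS => n.
  rewrite -v0E !sub0r !normrN (ger0_norm (v_ge0 n)) ger0_norm ?powR_ge0// => vd.
  rewrite -[e]powRr1 ?(ltW e0)// -(mulVf (lt0r_neq0 p0)) powRrM.
  by apply: gt0_ltr_powR; rewrite ?nnegrE ?powR_ge0.
- have cont : x `^ p @[x --> v0] --> v0 `^ p.
    have := @derivable_powR R 1 p v0; rewrite in_itv/= v0_gt0 => /(_ isT).
    by move/derivable1_diffP/differentiable_continuous.
  exact: (cvg_comp _ _ vv0 cont).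
Qed.

Lemma ln_le_subr1 {R : realType} (u : R) : 0 < u -> ln u <= u - 1.
Proof.
move=> u0; rewrite [X in ln X](_ : u = 1 + (u - 1)); last by ring.
by apply: le_ln1Dx; lra.
Qed.

(** Apply ln y < y to y = u ^ (- c), whose logarithm is - c ln u. *)
Lemma oppr_ln_le_powR {R : realType} (c u : R) : 0 < c -> 0 < u ->
  - ln u <= c^-1 * u `^ (- c).
Proof.
move=> c0 u0; rewrite mulrC ler_pdivlMr// mulrC -[leLHS]opprK -mulrN opprK.
rewrite -mulNr -ln_powR.
by apply/ltW/ln_sublinear/powR_gt0.
Qed.

(** * The entropy integrand phi: bounds near 0 and near 1, and continuity *)

Definition entropy_fun {R : realType} (a u : R) : R := u * (- ln u) `^ a.

Section entropy_fun.
Context {R : realType}.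
Implicit Types a b u : R.

Lemma entropy_fun_ge0 a u : 0 <= u -> 0 <= entropy_fun a u.
Proof. by move=> u0; rewrite mulr_ge0// powR_ge0. Qed.

(** The logarithm bound with c = 1 / (2 a), raised to the power a, gives (- ln u) ^ a <= (2 a) ^ a u
    ^ (- 1/2); the factor u leaves a square root. This controls the integrand near u = 0. *)
Lemma entropy_fun_le_powR a u : 0 < a -> 0 <= u <= 1 ->
  entropy_fun a u <= (2 * a) `^ a * u `^ 2^-1.
Proof.
move=> a0 /andP[]; rewrite le_eqVlt => /predU1P[<- _|u0 u1].
  by rewrite /entropy_fun mul0r mulr_ge0 ?powR_ge0.
have a2 : 0 <= 2 * a by rewrite mulr_ge0// ltW.
  have c0 : 0 < (2 * a)^-1 by rewrite invr_gt0 mulr_gt0.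
rewrite /entropy_fun; apply: (@le_trans _ _ (u * ((2 * a) `^ a * u `^ (- 2^-1)))).
  rewrite ler_wpM2l ?(ltW u0)//.
  apply: (@le_trans _ _ (((2 * a) * u `^ (- (2 * a)^-1)) `^ a)).
    apply: ge0_ler_powR; rewrite ?nnegrE ?(ltW a0) ?oppr_ge0 ?ln_le0//.
      by rewrite mulr_ge0// powR_ge0.
    by have := @oppr_ln_le_powR R (2 * a)^-1 u c0 u0; rewrite invrK.
  rewrite powRM ?powR_ge0// -powRrM.
  by rewrite invfM mulNr -mulrA mulVf ?mulr1// gt_eqF.
rewrite mulrCA ler_wpM2l ?powR_ge0// -{1}[u]powRr1 ?(ltW u0)//.
rewrite -powRD ?(lt0r_neq0 u0) ?implybT//.
by rewrite (_ : 1 - 2^-1 = 2^-1 :> R)//; lra.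
Qed.

(** For u <= 1/2 the integrand is bounded and (1 - u) ^ b is at least 2 ^ (- b). For u > 1/2, - ln u
    <= 1 / u - 1 <= 2 (1 - u), and lowering the exponent from a to b only increases a power of 1 - u
    <= 1. [C1] and [C2] are the constants of these two ranges. *)
Lemma entropy_fun_le_powR_onem a b : 0 < b -> b <= a ->
  exists2 C, 0 <= C &
    forall u, 0 <= u <= 1 -> entropy_fun a u <= C * (1 - u) `^ b.
Proof.
move=> b0 ba; have a0 : 0 < a by exact: lt_le_trans ba.
pose C1 : R := (2 * a) `^ a / 2^-1 `^ b; pose C2 : R := 2 `^ a.
have C1_ge0 : 0 <= C1 by rewrite divr_ge0 ?powR_ge0.
have C2_ge0 : 0 <= C2 by exact: powR_ge0.
exists (C1 + C2) => [|u u01]; first exact: addr_ge0.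
have /andP[u0 u1] := u01.
have [u12|u12] := leP u 2^-1.
- apply: (le_trans (entropy_fun_le_powR a0 u01)).
  apply: (@le_trans _ _ (C1 * (1 - u) `^ b)); last first.
    by rewrite ler_wpM2r ?powR_ge0// lerDl.
  rewrite /C1 -mulrA ler_wpM2l ?powR_ge0//.
  apply: (@le_trans _ _ 1).
    by rewrite -[leRHS](one_powR 2^-1); apply: ge0_ler_powR; rewrite ?nnegrE ?invr_ge0.
  rewrite mulrC ler_pdivlMr ?powR_gt0// mul1r.
  by apply: ge0_ler_powR; rewrite ?nnegrE ?subr_ge0 ?(ltW b0)//; lra.
- apply: (@le_trans _ _ (C2 * (1 - u) `^ b)); last first.
    by rewrite ler_wpM2r ?powR_ge0// lerDr.
  have u_gt0 : 0 < u by apply: lt_trans u12.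
  apply: (@le_trans _ _ (1 * (2 * (1 - u)) `^ a)).
    rewrite ler_pM ?powR_ge0//.
    apply: ge0_ler_powR; rewrite ?nnegrE ?oppr_ge0 ?ln_le0 ?(ltW a0)//; first by lra.
    rewrite -lnV//; apply: (@le_trans _ _ (u^-1 - 1)).
      by apply: ln_le_subr1; rewrite invr_gt0.
    rewrite -(ler_pM2r u_gt0) mulrBl mulVf ?gt_eqF// mul1r; nra.
  rewrite mul1r powRM// ?subr_ge0// ler_wpM2l//.
  move: u1; rewrite le_eqVlt => /predU1P[->|u1].
    by rewrite subrr !powR0 ?gt_eqF.
  by apply: ger_powR => //; lra.
Qed.

(** Since 1 - u <= - ln u, only the factor u >= 1/2 is lost. This is the converse estimate that
    turns a finite entropy into integrability of a power of the tail. *)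
Lemma powR_onem_le_entropy_fun a u : 0 <= a -> 2^-1 <= u <= 1 ->
  (1 - u) `^ a <= 2 * entropy_fun a u.
Proof.
move=> a0 /andP[u2 u1]; have u0 : 0 < u by apply: lt_le_trans u2.
apply: (@le_trans _ _ ((- ln u) `^ a)).
  apply: ge0_ler_powR; rewrite ?nnegrE ?subr_ge0 ?oppr_ge0 ?ln_le0//.
  by rewrite lerNr opprB ln_le_subr1.
rewrite /entropy_fun mulrA -[leLHS]mul1r ler_wpM2r ?powR_ge0//; lra.
Qed.

(** Because [ln 0 = 0], the logarithm is discontinuous at 0; a limit equal to 0 is therefore reached
    by squeezing below a multiple of the square root. *)
Lemma cvg_entropy_fun a (u : nat -> R) (u0 : R) : 0 < a ->
  (forall n, 0 <= u n <= 1) -> u @ \oo --> u0 ->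
  (fun n => entropy_fun a (u n)) @ \oo --> entropy_fun a u0.
Proof.
move=> a0 u01 uu0.
have : 0 <= u0.
  by apply: (cvgr_to_ge uu0); apply: nearW => n; have /andP[] := u01 n.
rewrite le_eqVlt => /predU1P[u0E|u0_gt0]; last first.
  apply: cvgM => //; apply: cvg_powR => //.
    by move=> n; rewrite oppr_ge0 ln_le0//; have /andP[] := u01 n.
  by apply: cvgN; apply: (cvg_comp _ _ uu0); exact: continuous_ln.
rewrite -u0E {2}/entropy_fun mul0r.
apply: (@squeeze_cvgr _ _ _ _ (cst 0) (fun n => (2 * a) `^ a * u n `^ 2^-1)).
- apply: nearW => n; rewrite entropy_fun_le_powR// andbT entropy_fun_ge0//.
  by have /andP[] := u01 n.
- exact: cvg_cst.
- rewrite -[X in _ --> X](mulr0 ((2 * a) `^ a)); apply: cvgMl_tmp.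
  rewrite -[X in _ --> X](@powR0 R 2^-1) ?invr_eq0 ?pnatr_eq0// u0E.
  by apply: cvg_powR => // n; have /andP[] := u01 n.
Qed.

End entropy_fun.

(** * Deterministic estimates: geometric sums and the excess of a power of the empirical tail *)

(* With s = (n * q) `^ (1 - b), cap s is the size of the mean of excess, relative
   to q `^ b, in both regimes of the latter. *)
Definition cap {R : realType} (s : R) : R := if s <= 1 then s else s^-1.

Lemma cap_ge0 {R : realType} (s : R) : 0 <= s -> 0 <= cap s.
Proof. by move=> s0; rewrite /cap; case: ifP => // _; rewrite invr_ge0. Qed.

(** For t >= 0, [cap t] is the minimum of t and 1 / t, so along a geometric progression it decays
    geometrically on both sides of 1. This makes the bound independent of both [N] and the starting
    point [s]. *)
Lemma sum_cap_geometric {R : realType} (r s : R) (N : nat) : 1 < r -> 0 <= s ->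
  \sum_(k < N) cap (r ^+ k * s) <= 2 * (1 + r) / (r - 1).
Proof.
move=> r1 s0; set C := _ / (r - 1).
have r10 : 0 < r - 1 by rewrite subr_gt0.
have C0 : 0 <= C by rewrite divr_ge0 ?(ltW r10)//; lra.
(* psi is bounded and cap t <= C * (psi (r * t) - psi t), so the sum telescopes. *)
pose psi (t : R) := t / (1 + t).
have step t : 0 <= t -> cap t <= C * (psi (r * t) - psi t).
  move=> t0; have d1 : 0 < 1 + t by lra.
  have d2 : 0 < 1 + r * t by nra.
  have -> : C * (psi (r * t) - psi t) = 2 * (1 + r) * t / ((1 + r * t) * (1 + t)).
    by rewrite /C /psi; field; rewrite !gt_eqF.
  rewrite ler_pdivlMr ?mulr_gt0// /cap; case: ifPn => [t1|].
    rewrite mulrC ler_wpM2r//.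
    have : (1 + r * t) <= 1 + r by nra.
    have : 1 + t <= 2 by lra.
    by move=> ? ?; rewrite mulrC ler_pM// ?ltW.
  rewrite -ltNge => t1; have t_gt0 : 0 < t by exact: lt_trans t1.
  rewrite -(ler_pM2r t_gt0) mulrAC mulVf ?(lt0r_neq0 t_gt0)// mul1r.
  have h1 : 1 + r * t <= (1 + r) * t by nra.
  have h2 : 1 + t <= 2 * t by lra.
  rewrite (_ : _ * t * t = (1 + r) * t * (2 * t)); last by ring.
  by rewrite ler_pM// ltW.
have psi01 t : 0 <= t -> 0 <= psi t <= 1.
  move=> t0; have d1 : 0 < 1 + t by lra.
  by rewrite divr_ge0 ?(ltW d1)//= ler_pdivrMr//; lra.
apply: (@le_trans _ _ (C * (psi (r ^+ N * s) - psi s))).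
  elim: N => [|N IH]; first by rewrite big_ord0 expr0 mul1r subrr mulr0.
  rewrite big_ord_recr/=.
  have t0 : 0 <= r ^+ N * s by rewrite mulr_ge0// exprn_ge0//; lra.
  have := lerD IH (step _ t0); rewrite mulrA -exprS => /le_trans; apply.
  by rewrite -mulrDr ler_wpM2l//; lra.
have t0 : 0 <= r ^+ N * s by rewrite mulr_ge0// exprn_ge0//; lra.
have /andP[? ?] := psi01 _ t0; have /andP[? ?] := psi01 _ s0.
by rewrite -[leRHS]mulr1 ler_wpM2l//; lra.
Qed.

(* The first regime uses that n * Q is a natural number, hence 0 or at least 1;
   the second that Q > 2 * q forces Q - q > q. *)
Definition excess {R : realType} (b n q Q : R) : R :=
  if n * q <= 1 then n `^ (1 - b) * Q else 4 * q `^ (b - 2) * (Q - q) ^+ 2.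

Lemma excess_ge0 {R : realType} (b n q Q : R) : 0 <= Q -> 0 <= excess b n q Q.
Proof.
move=> Q0; rewrite /excess; case: ifP => _; first by rewrite mulr_ge0 ?powR_ge0.
by rewrite mulr_ge0 ?sqr_ge0// mulr_ge0// powR_ge0.
Qed.

Lemma powRB2 {R : realType} (b q : R) : 0 < q -> q `^ (b - 2) = q `^ b / q ^+ 2.
Proof.
move=> q0; rewrite powRB ?(lt0r_neq0 q0) ?implybT//.
by rewrite -(powR_mulrn 2)// ltW.
Qed.

Lemma powR_le_excess {R : realType} (b n q Q : R) :
  0 < b < 1 -> 0 < n -> 0 <= q -> Q = 0 \/ 1 <= n * Q ->
  Q `^ b <= 2 * q `^ b + excess b n q Q.
Proof.
move=> /andP[b0 b1] n0 q0 [->|nQ].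
  rewrite powR0 ?gt_eqF//.
  by rewrite addr_ge0 ?excess_ge0// mulr_ge0 ?powR_ge0.
have Q0 : 0 < Q by rewrite -(pmulr_rgt0 _ n0); exact: lt_le_trans nQ.
rewrite /excess; case: ifPn => [_|].
  apply: (@le_trans _ _ (n `^ (1 - b) * Q)); last first.
    by rewrite lerDr mulr_ge0 ?powR_ge0.
  (* After multiplication by n ^ b the claim is (n Q) ^ b <= n Q, which holds because n Q >= 1 and b
     <= 1. *)
  rewrite powRB ?(lt0r_neq0 n0) ?implybT// powRr1 ?(ltW n0)//.
  rewrite mulrAC ler_pdivlMr ?powR_gt0// mulrC -powRM ?(ltW n0) ?(ltW Q0)//.
  by apply: ler1_powR => //; exact: ltW.
rewrite -ltNge => nq.
have q_gt0 : 0 < q by rewrite -(pmulr_rgt0 _ n0); exact: lt_trans nq.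
rewrite (powRB2 b q_gt0).
have [Qq|qQ] := leP Q (2 * q).
  apply: (@le_trans _ _ (2 * q `^ b)); last first.
    by rewrite lerDl mulr_ge0 ?sqr_ge0// mulr_ge0// divr_ge0 ?powR_ge0 ?sqr_ge0.
  apply: (@le_trans _ _ ((2 * q) `^ b)).
    by apply: ge0_ler_powR; rewrite ?nnegrE ?(ltW b0) ?(ltW Q0) ?mulr_ge0.
  rewrite powRM// ler_wpM2r ?powR_ge0//.
  by apply: ler1_powR; [lra|exact: ltW].
apply: (@le_trans _ _ (4 * (q `^ b / q ^+ 2) * (Q - q) ^+ 2)); last first.
  by rewrite lerDr mulr_ge0 ?powR_ge0.
(* As Q / q > 2, its power b is at most its square; and Q > 2 q gives Q <= 2 (Q - q), whence the
   constant 4. *)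
apply: (@le_trans _ _ (q `^ b * (Q / q) ^+ 2)).
  rewrite -{1}[Q](divfK (lt0r_neq0 q_gt0)) powRM ?divr_ge0 ?(ltW Q0)//.
  rewrite mulrC ler_wpM2l ?powR_ge0// -powR_mulrn ?divr_ge0 ?(ltW Q0)//.
  apply: ler_powR; last by lra.
  by rewrite ler_pdivlMr// mul1r; lra.
rewrite expr_div_n -!mulrA [leRHS]mulrCA ler_wpM2l ?powR_ge0//.
rewrite [leRHS]mulrCA [leLHS]mulrC [leLHS]mulrAC [leLHS]mulrC.
by rewrite ler_wpM2l ?invr_ge0 ?sqr_ge0//; nra.
Qed.

(** * True and empirical tails *)

Section empirical_tail.
Context d (T : measurableType d) {R : realType} (P : probability T R).

Definition tail (X : {RV P >-> R}) (x : R) : R := 1 - distr_fun X x.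

Lemma tailE (X : {RV P >-> R}) (x : R) : (tail X x)%:E = P [set w | x < X w].
Proof.
rewrite /tail /distr_fun EFinB fineK ?fin_num_measure// -ccdf_1_cdf.
by rewrite /ccdf /distribution /= /pushforward set_itvoy.
Qed.

Lemma distr_fun_01 (X : {RV P >-> R}) (x : R) : 0 <= distr_fun X x <= 1.
Proof.
rewrite -!lee_fin /distr_fun fineK ?fin_num_measure//.
by rewrite cdf_ge0 cdf_le1.
Qed.

Lemma tail_01 (X : {RV P >-> R}) (x : R) : 0 <= tail X x <= 1.
Proof. by rewrite /tail; have := distr_fun_01 X x; lra. Qed.

Lemma measurable_distr_fun (X : {RV P >-> R}) :
  measurable_fun [set: R] (distr_fun X).
Proof.
apply/measurable_EFinP; apply: (eq_measurable_fun (cdf X)) => [r _|].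
  by rewrite /= fineK// fin_num_measure.
exact: cdf_measurable.
Qed.

Lemma measurable_tail (X : {RV P >-> R}) : measurable_fun [set: R] (tail X).
Proof. by apply: measurable_funB => //; exact: measurable_distr_fun. Qed.

Definition emp_tail (Xs : nat -> T -> R) (n : nat) (w : T) (x : R) : R :=
  n%:R^-1 * \sum_(i < n) (x < Xs i w)%R%:R.

(** Stated for a nonempty sample: with no observation both averages are 0 and do not add up to 1. *)
Lemma emp_distr_fun_tail (Xs : nat -> T -> R) n w x :
  emp_distr_fun Xs n.+1 w x = 1 - emp_tail Xs n.+1 w x.
Proof.
rewrite /emp_distr_fun /emp_tail; apply/eqP; rewrite eq_sym subr_eq; apply/eqP.
rewrite -mulrDr -big_split/=.
under eq_bigr => i _ do rewrite ltNge -natrD addnC addn_negb.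
by rewrite sumr_const card_ord mulVf// pnatr_eq0.
Qed.

Variable Xs : nat -> {RV P >-> R}.
Local Notation Q := (emp_tail (fun i => Xs i : T -> R)).

Lemma emp_tail_ge0 n w x : 0 <= Q n w x.
Proof. by rewrite mulr_ge0 ?invr_ge0// sumr_ge0. Qed.

Lemma emp_tail_le1 n w x : Q n w x <= 1.
Proof.
case: n => [|n]; first by rewrite /emp_tail invr0 mul0r.
rewrite /emp_tail mulrC ler_pdivrMr// mul1r.
apply: (@le_trans _ _ (\sum_(i < n.+1) 1)).
  by apply: ler_sum => i _; rewrite lern1 leq_b1.
by rewrite sumr_const card_ord.
Qed.

(** The product of the sample size and the empirical tail counts the observations above x, so it is
    a natural number. *)
Lemma emp_tail_gap n w x : (0 < n)%N -> Q n w x = 0 \/ 1 <= n%:R * Q n w x.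
Proof.
move=> n0; rewrite /emp_tail mulrA divff ?mul1r; last by rewrite pnatr_eq0 -lt0n.
rewrite -natr_sum; have [->|s0] := posnP (\sum_(i < n) (x < Xs i w)%R)%N.
  by left; rewrite mulr0.
by right; rewrite ler1n.
Qed.

(** The number of observations above x can only grow with the sample. This compares a sample size
    with a later power of two. *)
Lemma emp_tail_le m n w x : (0 < m)%N -> (m <= n)%N ->
  Q m w x <= n%:R / m%:R * Q n w x.
Proof.
move=> m0 mn; have n0 : (0 < n)%N by exact: leq_trans mn.
rewrite /emp_tail [leRHS]mulrCA !mulrA mulVf ?mul1r; last by rewrite pnatr_eq0 -lt0n.
rewrite ler_wpM2l ?invr_ge0// -!(big_mkord xpredT (fun i => (x < Xs i w)%R%:R)).
by rewrite (big_cat_nat _ mn)//= lerDl sumr_ge0.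
Qed.

(** Measurability is joint in the outcome and the point, as Tonelli's theorem requires. *)
Lemma measurable_emp_tail n :
  measurable_fun [set: T * R] (fun z => Q n z.1 z.2).
Proof.
apply: measurable_funM => //; apply: measurable_sum => i.
apply: (measurableT_comp (f := fun b : bool => b%:R : R)) => //.
by apply: measurable_fun_ltr => //; exact: measurableT_comp.
Qed.

End empirical_tail.

(** * Mean and variance of the empirical tail *)

Section moments.
Context d (T : measurableType d) {R : realType} (P : probability T R).
Variables (X : {RV P >-> R}) (Xs : nat -> {RV P >-> R}).
Hypothesis Xs_indep : mutually_independent Xs.
Hypothesis Xs_distr : forall i, same_distribution (Xs i) X.
Local Notation Q := (emp_tail (fun i => Xs i : T -> R)).
Local Notation q := (tail X).
Local Notation exceed x i := [set w | x < Xs i w].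

Let measurable_exceed x i : measurable (exceed x i).
Proof.
rewrite -[X in measurable X]setTI.
have := @measurable_fun_ltr _ T R setT (cst x) (Xs i : T -> R).
move=> /(_ (measurable_cst _) (@measurable_funPT _ _ _ _ (Xs i))).
move=> /(_ measurableT [set true]); rewrite preimage_true; exact.
Qed.

Let prob_exceed x i : P (exceed x i) = (q x)%:E.
Proof.
rewrite tailE; have := Xs_distr i (measurable_itv `]x, +oo[).
by rewrite /distribution/= /pushforward set_itvoy.
Qed.

Let prob_exceedI x i j : i != j ->
  P (exceed x i `&` exceed x j) = (q x ^+ 2)%:E.
Proof.
(* The list of two indices is duplicate-free because i != j; both indices receive the same
   half-line. *)
move=> ij; have := Xs_indep (J := [:: i; j]) (B := fun=> `]x, +oo[%classic).
rewrite /= inE ij => /(_ isT (fun=> measurable_itv _)).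
rewrite !big_cons big_nil mule1 set_itvoy -/(exceed x i) -/(exceed x j).
rewrite !prob_exceed -EFinM -expr2 => <-; congr (P _).
apply/seteqP; split=> [w [wi wj] k/=|w h].
  by rewrite !inE => /orP[]/eqP->.
by split; apply: h; rewrite /= !inE eqxx ?orbT.
Qed.

Let integral_exceedM x i j :
  (\int[P]_w ((x < Xs i w)%R%:R * (x < Xs j w)%R%:R)%:E)%E =
  P (exceed x i `&` exceed x j).
Proof.
rewrite -[X in P X]setIT -integral_indic//; last exact: measurableI.
apply: eq_integral => w _; rewrite indicE in_setI -natrM mulnb.
by congr (((_ && _) : nat)%:R)%:E; apply/idP/idP => [h|/set_mem//]; exact/mem_set.
Qed.

Let measurable_ltb x i : measurable_fun [set: T] (fun w => (x < Xs i w)%R%:R : R).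
Proof.
apply: (measurableT_comp (f := fun b : bool => b%:R : R)) => //.
exact: measurable_fun_ltr.
Qed.

Lemma measurable_emp_tailx n x : measurable_fun [set: T] (fun w => Q n w x).
Proof. by apply: measurable_funM => //; exact: measurable_sum. Qed.

Lemma expectation_emp_tail n x : (0 < n)%N ->
  (\int[P]_w (Q n w x)%:E = (q x)%:E)%E.
Proof.
move=> n0; under eq_integral => w _ do rewrite EFinM -sumEFin.
rewrite ge0_integralZl_EFin ?invr_ge0//; last 2 first.
- by move=> w _; rewrite sume_ge0// => i _; rewrite lee_fin.
- by apply: emeasurable_sum => i; apply/measurable_EFinP.
rewrite ge0_integral_sum//; last by move=> i; apply/measurable_EFinP.
under eq_bigr => i _.
  rewrite (_ : (\int[P]_w _)%E = (q x)%:E).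
    over.
  rewrite -(prob_exceed x i) -[X in P X]setIid -integral_exceedM.
  by apply: eq_integral => w _; rewrite -natrM mulnb andbb.
rewrite sumEFin sumr_const card_ord -EFinM -[q x *+ n]mulr_natl mulrA mulVf ?mul1r//.
by rewrite pnatr_eq0 -lt0n.
Qed.

(** Expanding the square gives n diagonal terms of mean q and, by independence, n (n - 1)
    off-diagonal terms of mean q ^ 2. *)
Lemma expectation_emp_tail2 n x : (0 < n)%N ->
  (\int[P]_w (Q n w x ^+ 2)%:E = (q x ^+ 2 + (q x - q x ^+ 2) / n%:R)%:E)%E.
Proof.
move=> n0.
transitivity (\int[P]_w ((n%:R^-1 ^+ 2)%:E * \sum_(i < n) \sum_(j < n)
    ((x < Xs i w)%R%:R * (x < Xs j w)%R%:R)%:E)%E)%E.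
  apply: eq_integral => w _; rewrite /emp_tail exprMn EFinM; congr (_ * _)%E.
  under [RHS]eq_bigr => i _ do rewrite sumEFin -mulr_sumr.
  by rewrite sumEFin -mulr_suml expr2.
have mM i j : measurable_fun [set: T] (fun w =>
    ((x < Xs i w)%R%:R * (x < Xs j w)%R%:R : R)%:E).
  by apply/measurable_EFinP; apply: measurable_funM.
have M0 i j w : (0 <= ((x < Xs i w)%R%:R * (x < Xs j w)%R%:R : R)%:E)%E.
  by rewrite lee_fin mulr_ge0.
rewrite ge0_integralZl_EFin ?sqr_ge0 ?invr_ge0//; last 2 first.
- by move=> w _; rewrite sume_ge0// => i _; rewrite sume_ge0.
- by apply: emeasurable_sum => i; apply: emeasurable_sum.
rewrite ge0_integral_sum//; last 2 first.
- by move=> i; exact: emeasurable_sum.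
- by move=> i w _; rewrite sume_ge0.
under eq_bigr => i _.
  rewrite ge0_integral_sum// (bigD1 i)//= integral_exceedM setIid prob_exceed.
  under eq_bigr => j ji.
    rewrite integral_exceedM prob_exceedI; last by rewrite eq_sym.
    over.
  rewrite sumEFin sumr_const (cardC1 i) card_ord -EFinD.
  over.
rewrite sumEFin sumr_const card_ord -EFinM; congr (_%:E).
case: n n0 => // m _; rewrite /= -[(q x + _) *+ _]mulr_natl -[_ *+ m]mulr_natl -natr1.
by field; rewrite natr1 pnatr_eq0.
Qed.

(** The variance is (q - q ^ 2) / n; dropping q ^ 2 leaves a bound linear in q, hence integrable in
    x wherever q is. *)
Lemma expectation_emp_tail_sqr_dev n x : (0 < n)%N ->
  (\int[P]_w ((Q n w x - q x) ^+ 2)%:E <= (q x / n%:R)%:E)%E.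
Proof.
move=> n0; have /andP[q0 q1] := tail_01 X x.
have mQ := measurable_emp_tailx n x.
have key : (\int[P]_w ((Q n w x - q x) ^+ 2)%:E + (2 * q x ^+ 2)%:E =
    (q x ^+ 2 + (q x - q x ^+ 2) / n%:R + q x ^+ 2)%:E)%E.
  rewrite EFinD -expectation_emp_tail2//.
  (* Moving the cross term to the other side keeps all integrands nonnegative. *)
  transitivity (\int[P]_w (((Q n w x - q x) ^+ 2)%:E + (2 * q x * Q n w x)%:E))%E.
    rewrite ge0_integralD//.
    - congr (_ + _)%E; under eq_integral do rewrite EFinM.
      rewrite ge0_integralZl_EFin ?mulr_ge0//.
      + by rewrite expectation_emp_tail// -EFinM expr2 mulrA.
      + by move=> w _; rewrite lee_fin emp_tail_ge0.
      + exact/measurable_EFinP.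
    - by move=> w _; rewrite lee_fin sqr_ge0.
    - by apply/measurable_EFinP/measurable_funX/measurable_funB.
    - by move=> w _; rewrite lee_fin mulr_ge0 ?emp_tail_ge0// mulr_ge0.
    - by apply/measurable_EFinP; exact: measurable_funM.
  transitivity (\int[P]_w ((Q n w x ^+ 2)%:E + (q x ^+ 2)%:E))%E.
    by apply: eq_integral => w _; rewrite -!EFinD; congr (_%:E); ring.
  rewrite ge0_integralD//.
  - rewrite integral_cst//; congr (_ + _)%E; rewrite -[RHS]mule1.
    by congr (_ * _)%E; exact: probability_setT.
  - by move=> w _; rewrite lee_fin sqr_ge0.
  - by apply/measurable_EFinP/measurable_funX.
  - by move=> w _; rewrite lee_fin sqr_ge0.
(* The right-hand side of [key] is real, which rules out infinite values of the integral and allows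
   solving for it in real arithmetic. *)
move: key; case: (\int[P]_w _)%E => [v| |]//= [key]; rewrite lee_fin.
have -> : v = (q x - q x ^+ 2) / n%:R by move: key; set c := _ / _; lra.
by rewrite ler_wpM2r ?invr_ge0// lerBlDr lerDl sqr_ge0.
Qed.

End moments.

(** * Series of nonnegative functions and Tonelli's theorem *)

Lemma nneseries_le {R : realType} (u : nat -> R) (M : R) : (forall k, 0 <= u k) ->
  (forall N, \sum_(k < N) u k <= M) -> (\sum_(k <oo) (u k)%:E <= M%:E)%E.
Proof.
move=> u0 uM; apply: lime_le.
  by apply: is_cvg_nneseries => k _ _; rewrite lee_fin.
by apply: nearW => N; rewrite sumEFin lee_fin big_mkord.
Qed.

(** By Tonelli the mean over w of the integral over x equals the integral over x of the summed
    means, which is at most that of [h]. A nonnegative function with finite mean is finite almost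
    surely. *)
Lemma ae_integral_nneseries_lty d (T : measurableType d) {R : realType}
    (P : probability T R) (D : set (measurableTypeR R))
    (g : nat -> T * measurableTypeR R -> R) (h : measurableTypeR R -> R) :
  measurable D -> (forall k, measurable_fun [set: T * measurableTypeR R] (g k)) ->
  (forall k z, 0 <= g k z) -> measurable_fun D h ->
  (forall x, D x -> \sum_(k <oo) \int[P]_w (g k (w, x))%:E <= (h x)%:E)%E ->
  (\int[@lebesgue_measure R]_(x in D) (h x)%:E < +oo)%E ->
  {ae P, forall w, (\int[@lebesgue_measure R]_(x in D)
    (\sum_(k <oo) (g k (w, x))%:E) < +oo)%E}.
Proof.
move=> mD mg g0 mh gh hoo.
pose DT : set (T * measurableTypeR R) := setT `*` D.
have mDT : measurable DT by exact: measurableX.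
pose G (z : T * measurableTypeR R) := (\sum_(k <oo) (g k z)%:E)%E.
have G0 z : (0 <= G z)%E by apply: nneseries_ge0 => k _ _; rewrite lee_fin.
have mG : measurable_fun [set: T * measurableTypeR R] G.
  apply: ge0_emeasurable_sum => [k z _ _|k _]; first by rewrite lee_fin.
  exact/measurable_EFinP.
(* Extending by 0 off [D] allows Tonelli's theorem to be applied on the whole product space. *)
pose f := G \_ DT.
have f0 z : (0 <= f z)%E by exact: erestrict_ge0.
have mf : measurable_fun [set: T * measurableTypeR R] f.
  by apply/(measurable_restrictT _ mDT); exact: measurable_funTS.
have fE w x : f (w, x) = ((fun x => G (w, x)) \_ D) x.
  by rewrite /f !patchE /DT in_setX in_setT.
have mGx x : measurable_fun [set: T] (fun w => G (w, x)).
  by apply: measurableT_comp => //; exact: measurable_fun_pair.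
have FE w : (\int[@lebesgue_measure R]_x f (w, x) =
             \int[@lebesgue_measure R]_(x in D) G (w, x))%E.
  by rewrite [RHS]integral_mkcond; apply: eq_integral => x _; rewrite fE.
have int_f : (\int[P]_w \int[@lebesgue_measure R]_x f (w, x) < +oo)%E.
  rewrite (fubini_tonelli f)//; apply: le_lt_trans hoo.
  rewrite [leRHS]integral_mkcond; apply: ge0_le_integral => //.
  - by move=> x _; exact: integral_ge0.
  - exact: measurable_fun_fubini_tonelli_G.
  - by apply/(measurable_restrictT _ mD); apply/measurable_EFinP.
  - move=> x _; rewrite patchE; case: ifPn => xD.
      under eq_integral do rewrite fE patchE xD.
      rewrite integral_nneseries//; first by apply: gh; exact: set_mem.
      + move=> k; apply/measurable_EFinP; exact: measurable_fun_pair1.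
      + by move=> k w _; rewrite lee_fin.
    by under eq_integral do rewrite fE patchE (negbTE xD); rewrite integral0.
have : P.-integrable setT (fun w => \int[@lebesgue_measure R]_x f (w, x))%E.
  apply/integrableP; split; first exact: measurable_fun_fubini_tonelli_F.
  by under eq_integral do rewrite gee0_abs ?integral_ge0//.
move/(integrable_ae measurableT); apply: filterS => w /(_ I).
by rewrite FE => /fin_numPlt/andP[].
Qed.

(** * Almost sure convergence and domination of the empirical tails *)

Lemma sum_inv_sqr_le {R : realType} (N : nat) :
  \sum_(k < N) ((k.+1 ^ 2)%:R : R)^-1 <= 2.
Proof.
case: N => [|N]; first by rewrite big_ord0.
(* The sharper bound carries the induction, because 1 / (x + 1) ^ 2 <= 1 / x - 1 / (x + 1). *)
apply: (@le_trans _ _ (2 - N.+1%:R^-1)); last by rewrite gerBl invr_ge0.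
elim: N => [|N IH]; first by rewrite big_ord1 exp1n invr1; lra.
rewrite big_ord_recr/=; apply: (le_trans (lerD IH (lexx _))).
have N0 : 0 < N.+1%:R :> R by rewrite ltr0n.
rewrite natrX -(natr1 N.+1); set x : R := N.+1%:R in N0 *.
rewrite -subr_ge0.
have -> : 2 - (x + 1)^-1 - (2 - x^-1 + ((x + 1) ^+ 2)^-1) = (x * (x + 1) ^+ 2)^-1.
  by field; rewrite !gt_eqF//; lra.
by rewrite invr_ge0 mulr_ge0 ?sqr_ge0// ltW.
Qed.

Lemma sqrt_bracket (n : nat) : exists k, (k ^ 2 <= n < k.+1 ^ 2)%N.
Proof.
elim: n => [|n [k /andP[kn nk]]]; first by exists 0%N.
have [h|h] := ltnP n.+1 (k.+1 ^ 2).
  by exists k; rewrite h andbT (leq_trans kn).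
exists k.+1; rewrite h/=; apply: (leq_ltn_trans nk).
by rewrite ltn_exp2r.
Qed.

Section almost_sure.
Context d (T : measurableType d) {R : realType} (P : probability T R).
Variables (X : {RV P >-> R}) (Xs : nat -> {RV P >-> R}).
Hypothesis Xs_indep : mutually_independent Xs.
Hypothesis Xs_distr : forall i, same_distribution (Xs i) X.
Local Notation Q := (emp_tail (fun i => Xs i : T -> R)).
Local Notation q := (tail X).

(** The tail for n observations averages the one for the first m, with weight m / n, and the
    proportion among the later ones, with weight 1 - m / n. Both proportions lie in [0, 1]. *)
Lemma emp_tail_dist m n w x : (0 < m)%N -> (m <= n)%N ->
  `|Q n w x - Q m w x| <= 1 - m%:R / n%:R.
Proof.
move=> m0 mn; have n0 : (0 < n)%N by exact: leq_trans mn.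
have m0' : 0 < m%:R :> R by rewrite ltr0n.
have n0' : 0 < n%:R :> R by rewrite ltr0n.
have Qm0 := emp_tail_ge0 Xs m w x; have Qm1 := emp_tail_le1 Xs m w x.
have h1 := emp_tail_le Xs w x m0 mn.
have h2 : n%:R * Q n w x <= m%:R * Q m w x + (n%:R - m%:R).
  rewrite /emp_tail !mulrA !divff ?gt_eqF// !mul1r.
  rewrite -!(big_mkord xpredT (fun i => (x < Xs i w)%R%:R)).
  rewrite (big_cat_nat _ mn)//= lerD2l -natrB//.
  apply: (@le_trans _ _ (\sum_(m <= i < n) 1)).
    by apply: ler_sum => i _; rewrite lern1 leq_b1.
  by rewrite sumr_const_nat.
have mn1 : m%:R / n%:R <= 1 :> R by rewrite ler_pdivrMr// mul1r ler_nat.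
have h3 : m%:R / n%:R * Q m w x <= Q n w x.
  move: h1; rewrite mulrAC ler_pdivlMr// mulrC => h1.
  by rewrite mulrAC ler_pdivrMr// [Q n w x * _]mulrC.
have h4 : Q n w x <= m%:R / n%:R * Q m w x + (1 - m%:R / n%:R).
  rewrite -(ler_pM2l n0'); apply: (le_trans h2).
  by rewrite mulrDr mulrBr mulr1 !mulrA [n%:R * m%:R]mulrC mulfK ?gt_eqF.
move: h3 h4 mn1; set r := m%:R / n%:R => h3 h4 mn1.
by rewrite ler_norml; nra.
Qed.

(** If m = (k + 1) ^ 2 <= n < (k + 2) ^ 2, then n - m <= 2 (k + 1), so the two tails differ by at
    most 1 - m / n <= 2 / (k + 1). *)
Lemma cvg_emp_tail_squares w x (c : R) :
  (fun k => Q (k.+1 ^ 2) w x) @ \oo --> c -> (fun n => Q n w x) @ \oo --> c.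
Proof.
move=> sq; apply/cvgrPdist_lt => e e0.
have e2 : 0 < e / 2 by rewrite divr_gt0.
move/cvgrPdist_lt : sq => /(_ _ e2)[K _ HK].
have [L _ HL] : \forall k \near \oo, 2 / k.+1%:R < e / 2.
  have : (fun k => 2 * k.+1%:R^-1 : R) @ \oo --> (2 * 0 : R).
    by apply: cvgMl_tmp; exact: cvg_harmonic.
  rewrite mulr0 => /cvgrPdist_lt/(_ _ e2); apply: filterS => k.
  by rewrite sub0r normrN ger0_norm// divr_ge0.
exists ((maxn K L).+2 ^ 2)%N => //= n/= Kn.
have [[|k] /andP[kn nk]] := sqrt_bracket n.
  by have := leq_ltn_trans Kn nk; rewrite ltn_exp2r.
have := leq_ltn_trans Kn nk; rewrite ltn_exp2r// ltnS ltnS => Kk.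
have k1 : 0 < k.+1%:R :> R by rewrite ltr0n.
have kn' : (0 < k.+1 ^ 2)%N by rewrite expn_gt0.
have n0 : 0 < n%:R :> R by rewrite ltr0n (leq_trans kn').
have h1 := HK k (leq_trans (leq_maxl K L) (ltnW Kk)).
have h2 := HL k (leq_trans (leq_maxr K L) (ltnW Kk)).
have h3 := emp_tail_dist w x kn' kn.
suff h4 : 1 - (k.+1 ^ 2)%:R / n%:R <= 2 / k.+1%:R :> R.
  rewrite -[c - _](subrKA (Q (k.+1 ^ 2) w x)).
  apply: (le_lt_trans (ler_normD _ _)); rewrite [e]splitr ltrD//.
  by rewrite distrC; apply: le_lt_trans h2; exact: le_trans h4.
have -> : 1 - (k.+1 ^ 2)%:R / n%:R = (n%:R - (k.+1 ^ 2)%:R) / n%:R :> R.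
  by rewrite mulrBl divff ?gt_eqF.
rewrite ler_pdivrMr// mulrAC ler_pdivlMr//.
have h5 : n%:R - (k.+1 ^ 2)%:R <= 2 * k.+1%:R :> R.
  rewrite lerBlDr -!natrM -natrD ler_nat.
  by move: nk; rewrite -!mulnn; lia.
apply: (@le_trans _ _ (2 * k.+1%:R * k.+1%:R)); first by rewrite ler_wpM2r// ltW.
by rewrite -mulrA ler_wpM2l// -natrM ler_nat mulnn.
Qed.

Lemma measurable_emp_tail_dev n : measurable_fun
  [set: T * measurableTypeR R] (fun z => Q n z.1 z.2 - q z.2).
Proof.
apply: measurable_funB; first exact: measurable_emp_tail.
by apply: measurableT_comp => //; exact: measurable_tail.
Qed.

(** Along squares the mean square deviations sum to at most 2 q, so the series of squared deviations
    converges and its terms vanish in the limit. Integrating over both variables at once yields one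
    null set of outcomes, outside which almost every x is good. *)
Lemma ae_cvg_emp_tail (D : set (measurableTypeR R)) : measurable D ->
  (\int[@lebesgue_measure R]_(x in D) (q x)%:E < +oo)%E ->
  {ae P, forall w, {ae @lebesgue_measure R, forall x, D x ->
    (fun n => Q n w x) @ \oo --> q x}}.
Proof.
move=> mD qoo.
pose g k (z : T * measurableTypeR R) := (Q (k.+1 ^ 2) z.1 z.2 - q z.2) ^+ 2.
have mg k : measurable_fun setT (g k).
  by apply: measurable_funX; exact: measurable_emp_tail_dev.
have g0 k z : 0 <= g k z by exact: sqr_ge0.
have mq : measurable_fun D q by apply: measurable_funTS; exact: measurable_tail.
have : {ae P, forall w, (\int[@lebesgue_measure R]_(x in D)
    (\sum_(k <oo) (g k (w, x))%:E) < +oo)%E}.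
  apply: (ae_integral_nneseries_lty (h := fun x => 2 * q x)) => //.
  - exact: measurable_funM.
  - move=> x Dx; have /andP[q0 _] := tail_01 X x.
    apply: (@le_trans _ _ (\sum_(k <oo) (q x / (k.+1 ^ 2)%:R)%:E)%E).
      apply: lee_nneseries => [k _ _|k _].
        by apply: integral_ge0 => w _; rewrite lee_fin.
      by apply: expectation_emp_tail_sqr_dev; rewrite ?expn_gt0.
    apply: nneseries_le => [k|N]; first by rewrite divr_ge0.
    by rewrite -mulr_sumr mulrC ler_wpM2r// sum_inv_sqr_le.
  - under eq_integral do rewrite EFinM.
    rewrite ge0_integralZl_EFin//.
    + by rewrite lte_mul_pinfty.
    + by move=> x _; rewrite lee_fin; have /andP[] := tail_01 X x.
    + exact/measurable_EFinP.
apply: filterS => w goo.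
have : (@lebesgue_measure R).-integrable D
    (fun x => \sum_(k <oo) (g k (w, x))%:E)%E.
  apply/integrableP; split.
    apply: ge0_emeasurable_sum => [k x _ _|k _]; first by rewrite lee_fin.
    apply/measurable_EFinP/measurable_funTS.
    exact: measurable_fun_pair2.
  under eq_integral => x _.
    rewrite gee0_abs; last by apply: nneseries_ge0 => k _ _; rewrite lee_fin.
    over.
  by [].
move/(integrable_ae mD); apply: filterS => x + Dx => /(_ Dx)/fin_numPlt/andP[_].
move=> soo; apply: cvg_emp_tail_squares.
have /cvg_series_cvg_0 : cvgn (series (fun k => g k (w, x))).
  exact: nnseries_is_cvg.
move/(cvg_powR (_ : 0 < 2^-1) _)=> h.
have {}h : (fun k => `|Q (k.+1 ^ 2) w x - q x|) @ \oo --> (0 : R).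
  rewrite -(@powR0 R 2^-1) ?invr_eq0 ?pnatr_eq0//.
  under eq_fun do rewrite -sqrtr_sqr -powR12_sqrt ?sqr_ge0//.
  by apply: h.
by apply/subr_cvg0; exact/norm_cvg0P.
Qed.

(** With n = 2 ^ k, the argument of [cap] is (n q) ^ (1 - b). If n q <= 1, the mean n ^ (1 - b) q
    equals q ^ b (n q) ^ (1 - b). If n q > 1, the variance bound gives 4 q ^ b / (n q), and 1 / (n
    q) is at most (n q) ^ (b - 1). *)
Lemma expectation_excess_le b k x : 0 < b < 1 ->
  (\int[P]_w (excess b (2 ^ k)%:R (q x) (Q (2 ^ k) w x))%:E <=
   (4 * q x `^ b * cap ((2 `^ (1 - b)) ^+ k * q x `^ (1 - b)))%:E)%E.
Proof.
move=> /andP[b0 b1]; have /andP[q0 q1] := tail_01 X x.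
have k0 : (0 < 2 ^ k)%N by rewrite expn_gt0.
set n : R := (2 ^ k)%:R; have n0 : 0 < n by rewrite ltr0n.
have mQ := measurable_emp_tailx Xs (2 ^ k) x.
have -> : (2 `^ (1 - b)) ^+ k * q x `^ (1 - b) = (n * q x) `^ (1 - b).
  rewrite powRM ?(ltW n0)//; congr (_ * _).
  by rewrite /n natrX -(powR_mulrn k (powR_ge0 2 _)) -(powR_mulrn k (ler0n R 2)) powRAC.
have [nq1|nq1] := leP (n * q x) 1.
- under eq_integral do rewrite /excess nq1 EFinM.
  rewrite ge0_integralZl_EFin ?powR_ge0//; last 2 first.
  + by move=> w _; rewrite lee_fin emp_tail_ge0.
  + exact/measurable_EFinP.
  rewrite (expectation_emp_tail Xs_distr)// -EFinM lee_fin /cap ifT; last first.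
    rewrite -[leRHS](one_powR (1 - b)); apply: ge0_ler_powR; rewrite ?nnegrE//.
    - by rewrite subr_ge0 ltW.
    - by rewrite mulr_ge0// ltW.
  have {1}-> : q x = q x `^ (1 - b) * q x `^ b.
    by rewrite -powRD ?subrK ?powRr1// oner_eq0.
  rewrite powRM ?(ltW n0)// -[4 * _ * _]mulrA [q x `^ b * _]mulrC -mulrA.
  by rewrite ler_peMl ?mulr_ge0 ?powR_ge0//; lra.
- have q_gt0 : 0 < q x by rewrite -(pmulr_rgt0 _ n0); exact: lt_trans nq1.
  under eq_integral do rewrite /excess leNgt nq1 EFinM.
  rewrite ge0_integralZl_EFin ?mulr_ge0 ?powR_ge0//; last 2 first.
  + by move=> w _; rewrite lee_fin sqr_ge0.
  + by apply/measurable_EFinP/measurable_funX/measurable_funB.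
  apply: (@le_trans _ _ ((4 * q x `^ (b - 2))%:E * (q x / n)%:E)%E).
    rewrite lee_wpmul2l ?lee_fin ?mulr_ge0 ?powR_ge0//.
    exact: expectation_emp_tail_sqr_dev.
  rewrite -EFinM lee_fin powRB2// -!mulrA ler_wpM2l// ler_wpM2l ?powR_ge0//.
  have nq0 : 0 < n * q x by rewrite mulr_gt0.
  have -> : (q x ^+ 2)^-1 * (q x / n) = (n * q x)^-1.
    by field; rewrite !gt_eqF.
  have s1 : 1 <= (n * q x) `^ (1 - b).
    rewrite -[leLHS](one_powR (1 - b)); apply: ge0_ler_powR;
      rewrite ?nnegrE ?(ltW nq0) ?(ltW nq1)//.
    by rewrite subr_ge0 ltW.
  apply: (@le_trans _ _ ((n * q x) `^ (1 - b))^-1).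
    rewrite lef_pV2 ?posrE ?powR_gt0//.
    by apply: ler1_powR; [exact: ltW|rewrite gerBl ltW].
  (* The value 1 falls in the other branch of [cap], where [s1] puts 1 between the inverse and the
     power. *)
  rewrite /cap; case: ifPn => // s2.
  by rewrite (le_trans _ s1)// invf_le1// (lt_le_trans ltr01).
Qed.

Lemma ae_emp_tail_powR_dominated b (D : set (measurableTypeR R)) :
  0 < b < 1 -> measurable D ->
  (\int[@lebesgue_measure R]_(x in D) (q x `^ b)%:E < +oo)%E ->
  {ae P, forall w, exists2 g, (@lebesgue_measure R).-integrable D g &
    forall n x, D x -> ((Q n.+1 w x `^ b)%:E <= g x)%E}.
Proof.
move=> b01 mD qoo; have /andP[b0 b1] := b01.
have mqT : measurable_fun [set: measurableTypeR R] q by exact: measurable_tail.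
(* [r] is the ratio of the progression (2 ^ k q) ^ (1 - b), greater than 1 as b < 1, and [C] is the
   bound of [sum_cap_geometric] for it. *)
pose r : R := 2 `^ (1 - b); pose C : R := 2 * (1 + r) / (r - 1).
have r1 : 1 < r.
  rewrite -[ltLHS](one_powR (1 - b)).
  by apply: gt0_ltr_powR; rewrite ?nnegrE ?subr_gt0//; lra.
have C0 : 0 <= C by rewrite divr_ge0 ?subr_ge0 ?(ltW r1)//; lra.
have C4 : 0 <= 4 * C by exact: mulr_ge0.
pose g k (z : T * measurableTypeR R) :=
  excess b (2 ^ k)%:R (q z.2) (Q (2 ^ k) z.1 z.2).
have mg k : measurable_fun setT (g k).
  have mq2 : measurable_fun [set: T * measurableTypeR R] (fun z => q z.2).
    by apply: measurableT_comp => //; exact: measurable_snd.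
  rewrite /g /excess; apply: measurable_fun_ifT.
  - by apply: measurable_fun_ler => //; exact: measurable_funM.
  - by apply: measurable_funM => //; exact: measurable_emp_tail.
  - apply: measurable_funM.
      apply: measurable_funM => //.
      by apply: (measurableT_comp (measurable_powR _)).
    by apply: measurable_funX; exact: measurable_emp_tail_dev.
have g0 k z : 0 <= g k z by rewrite excess_ge0// emp_tail_ge0.
have mqb : measurable_fun D (fun x => q x `^ b).
  by apply: (measurableT_comp (measurable_powR _)); exact: measurable_funTS.
have iqb : (@lebesgue_measure R).-integrable D (fun x => (q x `^ b)%:E).
  apply/integrableP; split; first exact/measurable_EFinP.
  by under eq_integral do rewrite gee0_abs ?lee_fin ?powR_ge0//.
have : {ae P, forall w, (\int[@lebesgue_measure R]_(x in D)
    (\sum_(k <oo) (g k (w, x))%:E) < +oo)%E}.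
  apply: (ae_integral_nneseries_lty (h := fun x => 4 * C * q x `^ b)) => //.
  - exact: measurable_funM.
  - move=> x Dx; have /andP[q0 _] := tail_01 X x.
    apply: (@le_trans _ _ (\sum_(k <oo)
        (4 * q x `^ b * cap (r ^+ k * q x `^ (1 - b)))%:E)%E).
      apply: lee_nneseries => [k _ _|k _].
        by apply: integral_ge0 => w _; rewrite lee_fin.
      exact: expectation_excess_le.
    have s0 k : 0 <= r ^+ k * q x `^ (1 - b).
      by rewrite mulr_ge0 ?powR_ge0// exprn_ge0// powR_ge0.
    apply: nneseries_le => [k|N].
      by rewrite mulr_ge0 ?cap_ge0// mulr_ge0 ?powR_ge0.
    rewrite -mulr_sumr [leRHS]mulrAC ler_wpM2l//; first by rewrite mulr_ge0// powR_ge0.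
    by apply: sum_cap_geometric; rewrite ?powR_ge0.
  - under eq_integral do rewrite EFinM.
    rewrite ge0_integralZl_EFin//.
    + by rewrite lte_mul_pinfty.
    + by move=> x _; rewrite lee_fin powR_ge0.
    + exact/measurable_EFinP.
apply: filterS => w goo.
have ig : (@lebesgue_measure R).-integrable D
    (fun x => \sum_(k <oo) (g k (w, x))%:E)%E.
  apply/integrableP; split.
    apply: ge0_emeasurable_sum => [k x _ _|k _]; first by rewrite lee_fin.
    apply/measurable_EFinP/measurable_funTS.
    exact: measurable_fun_pair2.
  under eq_integral => x _.
    rewrite gee0_abs; last by apply: nneseries_ge0 => k _ _; rewrite lee_fin.
    over.
  by [].
(* If [Q'] is the tail for the next power of two, then (2 Q') ^ b <= 2 Q' ^ b <= 4 q ^ b + 2 g (k +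
   1). Replacing the single excess by the whole series removes the dependence on n. *)
exists (fun x => 4%:E * (q x `^ b)%:E + 2%:E * \sum_(k <oo) (g k (w, x))%:E)%E.
  by apply: integrableD => //; exact: integrableZl.
move=> n x Dx; have /andP[q0 _] := tail_01 X x.
have /andP[nk kn] := trunc_log_bounds (isT : (1 < 2)%N) (isT : (0 < n.+1)%N).
set k := trunc_log 2 n.+1 in nk kn.
set Q' := Q (2 ^ k.+1) w x.
have Q'0 : 0 <= Q' by exact: emp_tail_ge0.
have QQ' : Q n.+1 w x <= 2 * Q'.
  apply: (le_trans (emp_tail_le Xs w x (isT : (0 < n.+1)%N) (ltnW kn))).
  rewrite ler_wpM2r// ler_pdivrMr// -natrM ler_nat expnS.
  by rewrite leq_mul2l.
have dom : Q' `^ b <= 2 * q x `^ b + g k.+1 (w, x).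
  apply: powR_le_excess => //.
  by apply: emp_tail_gap; rewrite expn_gt0.
have gle : ((g k.+1 (w, x))%:E <= \sum_(k <oo) (g k (w, x))%:E)%E.
  apply: le_trans (nneseries_lim_ge k.+2 _); last by move=> i _ _; rewrite lee_fin.
  rewrite big_nat_recr//= leeDr// sume_ge0// => i _.
  by rewrite lee_fin.
apply: (@le_trans _ _ (4%:E * (q x `^ b)%:E + 2%:E * (g k.+1 (w, x))%:E)%E); last first.
  by rewrite leeD2l// lee_wpmul2l// lee_fin.
rewrite -!EFinM -EFinD lee_fin.
apply: (@le_trans _ _ (2 * Q' `^ b)); last by lra.
apply: (@le_trans _ _ ((2 * Q') `^ b)).
  apply: ge0_ler_powR => //; rewrite ?nnegrE; first exact: ltW.
    exact: emp_tail_ge0.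
  exact: mulr_ge0.
rewrite powRM// ler_wpM2r ?powR_ge0//.
by apply: ler1_powR; [lra|exact: ltW].
Qed.

End almost_sure.

(** * Integrability of powers of the true tail *)

Lemma cvg_powRN {R : realType} (t : R) : 0 < t ->
  x `^ (- t) @[x --> +oo] --> (0 : R).
Proof.
move=> t0; apply/cvgrPdist_lt => e e0; near=> x.
have x0 : 0 < x by near: x; exact: nbhs_pinfty_gt.
have xe : (e^-1) `^ t^-1 < x by near: x; exact: nbhs_pinfty_gt.
rewrite sub0r normrN ger0_norm ?powR_ge0// powRN invf_plt ?posrE ?powR_gt0//.
rewrite -[e^-1]powRr1 ?invr_ge0 ?(ltW e0)// -(mulVf (lt0r_neq0 t0)) powRrM.
by apply: gt0_ltr_powR; rewrite ?nnegrE ?powR_ge0 ?(ltW x0).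
Unshelve. all: by end_near. Qed.

Lemma integral_powRN_lty {R : realType} (s : R) : 1 < s ->
  (\int[@lebesgue_measure R]_(x in `[1%R, +oo[) (x `^ (- s))%:E < +oo)%E.
Proof.
(* This antiderivative of x ^ (- s) tends to 0 at infinity because s > 1. *)
move=> s1; pose F (x : R) := (1 - s)^-1 * x `^ (1 - s).
have s10 : 1 - s != 0 by rewrite subr_eq0 lt_eqF.
have dF (x : R) : 0 < x -> is_derive x 1 F (x `^ (- s)).
  move=> x0; have -> : x `^ (- s) = (1 - s)^-1 *: ((1 - s) * x `^ (1 - s - 1)).
    by rewrite scalerA mulVf// scale1r; congr powR; ring.
  have h := is_derive1_powR (1 - s) x0.
  exact: (@is_deriveZ _ _ _ _ (1 - s)^-1 x 1 _ h).
have cont (x : R) (r : R) : 0 < x -> y `^ r @[y --> x] --> x `^ r.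
  move=> x0; have := @derivable_powR R 1 r x; rewrite in_itv/= x0 => /(_ isT).
  by move/derivable1_diffP/differentiable_continuous.
rewrite (@ge0_continuous_FTC2y _ _ F _ 0).
- by rewrite -EFinB ltry.
- by move=> x _; exact: powR_ge0.
- apply: continuous_in_subspaceT => x; rewrite inE/= in_itv/= andbT => x1.
  by apply: cont; exact: lt_le_trans x1.
- rewrite -[X in _ --> X](mulr0 (1 - s)^-1); apply: cvgMl_tmp.
  by rewrite -[1 - s]opprB; apply: cvg_powRN; rewrite subr_gt0.
- by move=> x x1; apply: ex_derive; apply: dF; exact: lt_trans x1.
- apply: cvg_at_right_filter; apply: cvgMl_tmp; exact: cont.
- move=> x; rewrite in_itv/= andbT => x1.
  by rewrite derive1E; apply: derive_val; apply: dF; exact: lt_trans x1.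
Qed.

Section tail_integrability.
Context d (T : measurableType d) {R : realType} (P : probability T R).
Variable X : {RV P >-> R}.
Local Notation q := (tail X).

(** Markov's inequality, with the p-th absolute moment of X as [M]. *)
Lemma tail_le_powR p : 1 < p -> (X : T -> R) \in Lfun P p%:E ->
  exists2 M, 0 <= M & forall x, 0 < x -> q x <= M * x `^ (- p).
Proof.
move=> p1 XLp; have p0 : 0 < p by exact: lt_trans p1.
have := Lfun_integrable (ltW p1) XLp.
move/(integrable_fin_num measurableT); set E := (\int[P]_x _)%E => Efin.
exists (fine E).
  by rewrite fine_ge0// integral_ge0// => w _; rewrite lee_fin powR_ge0.
move=> x x0; rewrite powRN ler_pdivlMr ?powR_gt0// mulrC -lee_fin fineK//.
have := @markov _ _ _ P X (fun y : R => y `^ p) x x0 (measurable_powR p).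
have -> : 'E_P[((fun y : R => y `^ p) \o (fun x : R => `|x|) \o X)%R]%E = E.
  by rewrite unlock.
move=> /(_ (fun _ _ => powR_ge0 _ _)) H; apply: le_trans (H _); last first.
  by move=> y z; rewrite !nnegrE => y0 z0 yz; apply: ge0_ler_powR; rewrite ?nnegrE// ltW.
rewrite EFinM tailE lee_wpmul2l ?lee_fin ?powR_ge0// le_measure ?inE//.
- rewrite -[X in measurable X]setTI; have := @measurable_fun_ltr _ T R setT (cst x) X.
  move=> /(_ (measurable_cst _) (@measurable_funPT _ _ _ _ X)).
  by move=> /(_ measurableT [set true]); rewrite preimage_true; exact.
- rewrite -[X in measurable X]setTI.
  have mN : measurable_fun setT (fun w => `|X w|) by exact: measurableT_comp.
  have := @measurable_fun_ler _ T R setT (cst x) _ (measurable_cst _) mN.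
  by move=> /(_ measurableT [set true]); rewrite preimage_true; exact.
- move=> w /= xw; rewrite lee_fin (le_trans (ltW xw))//; exact: ler_norm.
Qed.

(** Below 1 the integrand is at most 1; from 1 on it is at most M ^ b x ^ (- p b), integrable as p b
    > 1. *)
Lemma integral_tail_powR_lty p b : 1 < p -> 0 < b -> 1 < p * b ->
  (X : T -> R) \in Lfun P p%:E ->
  (\int[@lebesgue_measure R]_(x in `]0%R, +oo[) (q x `^ b)%:E < +oo)%E.
Proof.
move=> p1 b0 pb1 XLp; have [M M0 qM] := tail_le_powR p1 XLp.
have mqb : measurable_fun [set: measurableTypeR R] (fun x => (q x `^ b)%:E).
  apply/measurable_EFinP; apply: (measurableT_comp (measurable_powR _)).
  exact: measurable_tail.
have -> : `]0, +oo[%classic = `]0, 1[%classic `|` `[1, +oo[%classic :> set R.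
  apply/seteqP; split=> x /=; rewrite !in_itv/= !andbT.
    by have [x1|x1] := ltP x 1 => x0; [left; rewrite x0|right].
  by move=> [/andP[]//|x1]; exact: lt_le_trans x1.
rewrite ge0_integral_setU//; last 3 first.
- exact: measurable_funTS.
- by move=> x _; rewrite lee_fin powR_ge0.
- apply/disj_setPS => x [] /=; rewrite !in_itv/= andbT => /andP[_ x1].
  by rewrite leNgt x1.
rewrite lte_add_pinfty//.
- apply: (@le_lt_trans _ _ (\int[@lebesgue_measure R]_(x in `]0%R, 1%R[) (cst 1%E x))%E).
    apply: ge0_le_integral => //.
    + by move=> x _; rewrite lee_fin powR_ge0.
    + exact: measurable_funTS.
    + move=> x _; rewrite lee_fin -[leRHS](one_powR b).
      have /andP[q0 q1] := tail_01 X x.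
      by apply: ge0_ler_powR; rewrite ?nnegrE// ltW.
  have E : lebesgue_measure (`]0, 1[%classic : set R) = 1%:E.
    by rewrite lebesgue_measure_itv/= lte_fin ltr01 -EFinB subr0.
  by rewrite integral_cst// mul1e [ltLHS]E ltry.
- apply: (@le_lt_trans _ _ (\int[@lebesgue_measure R]_(x in `[1%R, +oo[)
      ((M `^ b)%:E * (x `^ (- (p * b)))%:E))%E).
    apply: ge0_le_integral => //.
    + by move=> x _; rewrite lee_fin powR_ge0.
    + exact: measurable_funTS.
    + apply/measurable_EFinP/measurable_funM => //.
      by apply: measurable_funTS; exact: measurable_powR.
    + move=> x /=; rewrite in_itv/= andbT => x1.
      have x0 : 0 < x by exact: lt_le_trans x1.
      have /andP[q0 q1] := tail_01 X x.
      rewrite -EFinM lee_fin -mulNr powRrM -powRM ?powR_ge0//.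
      apply: ge0_ler_powR; rewrite ?nnegrE ?(ltW b0) ?mulr_ge0 ?powR_ge0//.
      exact: qM.
  rewrite ge0_integralZl_EFin ?powR_ge0//.
  + by rewrite lte_mul_pinfty ?lee_fin ?powR_ge0// integral_powRN_lty.
  + by move=> x _; rewrite lee_fin powR_ge0.
  + apply/measurable_EFinP; apply: measurable_funTS; exact: measurable_powR.
Qed.

End tail_integrability.

(** * Passing to the limit in the entropy integrals *)

(** The sequence lies above its running infima [einfs u], which converge to the lower limit. *)
Lemma cvge_pinfty_le_limn_einf {R : realType} (u : (\bar R)^nat) :
  (+oo <= limn_einf u)%E -> u @ \oo --> +oo%E.
Proof.
rewrite leye_eq => /eqP uoo; have cu := @cvg_einfs_sup R u.
have supE : ereal_sup (range (einfs u)) = +oo%E.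
  by rewrite -uoo limn_einf_lim; apply/esym/cvg_lim.
rewrite supE in cu; apply: gee_cvgy cu; apply: nearW => n.
by apply: ereal_inf_lbound; exists n => /=.
Qed.

Section entropy_integrals.
Context {R : realType}.
Local Notation mu := (@lebesgue_measure R).
Variables (D : set (measurableTypeR R)) (mD : measurable D) (a : R).
Hypothesis a_gt0 : 0 < a.
Variables (F_ : nat -> measurableTypeR R -> R) (F : measurableTypeR R -> R).
Hypothesis mF_ : forall n, measurable_fun D (F_ n).
Hypothesis F_01 : forall n x, 0 <= F_ n x <= 1.
Hypothesis mF : measurable_fun D F.
Hypothesis F01 : forall x, 0 <= F x <= 1.
Hypothesis F_F : {ae mu, forall x, D x -> (fun n => F_ n x) @ \oo --> F x}.

Lemma measurable_entropy_fun (G : measurableTypeR R -> R) : measurable_fun D G ->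
  measurable_fun D (fun x => (entropy_fun a (G x))%:E).
Proof.
move=> mG; apply/measurable_EFinP; apply: measurable_funM => //.
apply: (measurableT_comp (measurable_powR _)).
by apply: measurable_funN; exact: (measurableT_comp (@measurable_ln R)).
Qed.

Let phi_cvg : {ae mu, forall x, D x ->
  (fun n => (entropy_fun a (F_ n x))%:E) @ \oo --> (entropy_fun a (F x))%:E}.
Proof.
apply: filterS F_F => x h /h Fx; apply: cvg_EFin; first exact: nearW.
exact: cvg_entropy_fun.
Qed.

Lemma cvg_integral_entropy_dominated b g : 0 < b -> b <= a ->
  mu.-integrable D g ->
  (forall n x, D x -> (((1 - F_ n x) `^ b)%:E <= g x)%E) ->
  (fun n => \int[mu]_(x in D) (entropy_fun a (F_ n x))%:E)%E @ \oo -->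
  (\int[mu]_(x in D) (entropy_fun a (F x))%:E)%E.
Proof.
move=> b0 ba ig gF; have [C C0 HC] := entropy_fun_le_powR_onem b0 ba.
have [] := @dominated_convergence _ _ _ mu D mD
  (fun n x => (entropy_fun a (F_ n x))%:E) (fun x => (entropy_fun a (F x))%:E)
  (fun x => C%:E * g x)%E _ _ phi_cvg _ _ => //.
- by move=> n; exact: measurable_entropy_fun.
- exact: measurable_entropy_fun.
- exact: integrableZl.
- apply: nearW => x n Dx.
  have /andP[F0 _] := F_01 n x.
  rewrite gee0_abs ?lee_fin ?entropy_fun_ge0//.
  apply: (@le_trans _ _ (C%:E * ((1 - F_ n x) `^ b)%:E)%E).
    by rewrite -EFinM lee_fin HC.
  by rewrite lee_wpmul2l// gF.
Qed.

(** Fatou's lemma bounds the lower limit of the integrals from below by the integral of the almost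
    everywhere limit, which is infinite. *)
Lemma cvg_integral_entropy_pinfty :
  (\int[mu]_(x in D) (entropy_fun a (F x))%:E = +oo)%E ->
  (fun n => \int[mu]_(x in D) (entropy_fun a (F_ n x))%:E)%E @ \oo -->
  (\int[mu]_(x in D) (entropy_fun a (F x))%:E)%E.
Proof.
move=> phioo; rewrite phioo; apply: cvge_pinfty_le_limn_einf.
have mphi n := measurable_entropy_fun (mF_ n).
have phi0 n x : D x -> (0 <= (entropy_fun a (F_ n x))%:E)%E.
  by move=> _; rewrite lee_fin entropy_fun_ge0//; have /andP[] := F_01 n x.
apply: (le_trans _ (fatou mu mD mphi phi0)).
rewrite -phioo; apply: ae_ge0_le_integral => //.
- by move=> x _; rewrite lee_fin entropy_fun_ge0//; have /andP[] := F01 x.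
- exact: measurable_entropy_fun.
- move=> x _; rewrite limn_einf_lim; apply: lime_ge; first exact: is_cvg_einfs.
  apply: nearW => n; apply: le_ereal_inf_tmp => _ [k _ <-] /=.
  by rewrite lee_fin entropy_fun_ge0//; have /andP[] := F_01 k x.
- rewrite /limn_einf; apply: measurableT_comp => //.
  by apply: measurable_fun_limn_esup => n; exact: measurableT_comp.
- by apply: filterS phi_cvg => x h /h/cvg_limn_einf_sup[->].
Qed.

End entropy_integrals.

(** * The integration domain, and the case distinction on the order of the entropy *)

Lemma measurable_entropy_domain {R : realType} (l : \bar R) :
  measurable ([set x : R | (0 < x%:E < l)%E] : set (measurableTypeR R)).
Proof.
have -> : [set x : R | (0 < x%:E < l)%E] =
    `]0, +oo[%classic `&` (EFin @^-1` [set y | (y < l)%E]).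
  apply/seteqP; split=> x /=; rewrite in_itv/= andbT lte_fin.
    by move=> /andP[].
  by move=> [-> ->].
apply: measurableI => //; rewrite -[X in measurable X]setTI.
by apply: emeasurable_fun_infty_o => //; exact: measurable_EFin.
Qed.

Unset Implicit Arguments.
Set Strict Implicit.
Set Printing Implicit Defensive.

Theorem proposition5p1 (d : measure_display) (T : measurableType d)
    (R : realType) (P : probability T R)
    (X : {RV P >-> R}) (Xs : nat -> {RV P >-> R})
    (l : \bar R) (l_gt0 : (0 < l)%E)
    (X_range : {ae P, forall w, (0 <= (X w)%:E <= l)%E})
    (p : R) (p_gt1 : 1 < p)
    (X_Lp : (X : T -> R) \in Lfun P p%:E)
    (Xs_indep : mutually_independent Xs)
    (Xs_distr : forall i, same_distribution (Xs i) X)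
    (a : R) (a_gt0 : 0 < a) :
  {ae P, forall w,
    (CE l a (emp_distr_fun (fun i => (Xs i : T -> R)) n w))
      @[n --> \oo] --> CE l a (distr_fun X)}.
Proof.
pose mu := @lebesgue_measure R.
pose D : set (measurableTypeR R) := [set x : R | (0 < x%:E < l)%E].
have mD : measurable D by exact: measurable_entropy_domain.
have D_gt0 : D `<=` `]0%R, +oo[%classic.
  by move=> x /= /andP[+ _]; rewrite lte_fin in_itv/= andbT.
have mq : measurable_fun [set: measurableTypeR R] (tail X) by exact: measurable_tail.
have mqb b : measurable_fun [set: measurableTypeR R] (fun x => (tail X x `^ b)%:E).
  by apply/measurable_EFinP; apply: (measurableT_comp (measurable_powR _)).
(* The midpoint of 1 / p and 1 satisfies both b0 < 1 and p b0 > 1. *)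
pose b0 := (p^-1 + 1) / 2.
have p0 : 0 < p by exact: lt_trans p_gt1.
have pV1 : p^-1 < 1 by rewrite invf_lt1.
have pV0 : 0 < p^-1 by rewrite invr_gt0.
have b0_gt0 : 0 < b0 by rewrite /b0; lra.
have b0_lt1 : b0 < 1 by rewrite /b0; lra.
have pb0 : 1 < p * b0.
  by rewrite /b0 mulrA mulrDr divff ?gt_eqF// mulr1 ltr_pdivlMr//; lra.
have int_b0 : (\int[mu]_(x in D) (tail X x `^ b0)%:E < +oo)%E.
  apply: le_lt_trans (integral_tail_powR_lty p_gt1 b0_gt0 pb0 X_Lp).
  apply: ge0_subset_integral => //; first exact: measurable_funTS.
  by move=> x _; rewrite lee_fin powR_ge0.
have tail_le_powR_b0 x : tail X x <= tail X x `^ b0.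
  have /andP[+ q1] := tail_01 X x; rewrite le_eqVlt => /predU1P[<-|q0].
    exact: powR_ge0.
  by apply: ger1_powR; [rewrite q0|exact: ltW].
(* The first power of the tail has to be integrable for the almost sure convergence of the empirical
   tails. *)
have int_q : (\int[mu]_(x in D) (tail X x)%:E < +oo)%E.
  apply: le_lt_trans int_b0; apply: ge0_le_integral => //.
  - by move=> x _; rewrite lee_fin; have /andP[] := tail_01 X x.
  - by apply/measurable_EFinP; exact: measurable_funTS.
  - exact: measurable_funTS.
  - by move=> x _; rewrite lee_fin.
(* The real factor in front passes to the limit, and shifting the index by one skips the empty
   sample, for which the distribution function is not 1 minus the tail. *)
suff int_cvg : {ae P, forall w,
    (fun n => \int[mu]_(x in D)
      (entropy_fun a (emp_distr_fun (fun i => Xs i : T -> R) n.+1 w x))%:E)%E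
    @ \oo --> (\int[mu]_(x in D) (entropy_fun a (distr_fun X x))%:E)%E}.
  apply: filterS int_cvg => w cvgw; rewrite -cvg_shiftS; exact: cvgeZl.
have mFs n w : measurable_fun D
    (fun x => emp_distr_fun (fun i => Xs i : T -> R) n.+1 w x).
  under eq_fun do rewrite emp_distr_fun_tail.
  apply: measurable_funB => //; apply: measurable_funTS.
  have mQ : measurable_fun [set: T * measurableTypeR R]
      (fun z => emp_tail (fun i => Xs i : T -> R) n.+1 z.1 z.2).
    exact: measurable_emp_tail.
  exact: (measurable_fun_pair2 w mQ).
have Fs01 n w x : 0 <= emp_distr_fun (fun i => Xs i : T -> R) n.+1 w x <= 1.
  rewrite emp_distr_fun_tail.
  by have := emp_tail_ge0 Xs n.+1 w x; have := emp_tail_le1 Xs n.+1 w x; lra.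
have mF : measurable_fun D (distr_fun X).
  by apply: measurable_funTS; exact: measurable_distr_fun.
have F01 x : 0 <= distr_fun X x <= 1 by exact: distr_fun_01.
have pointwise : {ae P, forall w, {ae mu, forall x, D x ->
    (fun n => emp_distr_fun (fun i => Xs i : T -> R) n.+1 w x) @ \oo -->
    distr_fun X x}}.
  apply: filterS (ae_cvg_emp_tail Xs_indep Xs_distr mD int_q) => w.
  apply: filterS => x h /h {}h.
  under eq_fun do rewrite emp_distr_fun_tail.
  rewrite -[distr_fun X x](subKr 1); apply: cvgB; first exact: cvg_cst.
  by rewrite (cvg_shiftS (fun n => emp_tail (fun i => Xs i : T -> R) n w x)).
have dominated b : 0 < b < 1 -> b <= a ->
    (\int[mu]_(x in D) (tail X x `^ b)%:E < +oo)%E ->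
    {ae P, forall w,
    (fun n => \int[mu]_(x in D)
      (entropy_fun a (emp_distr_fun (fun i => Xs i : T -> R) n.+1 w x))%:E)%E
    @ \oo --> (\int[mu]_(x in D) (entropy_fun a (distr_fun X x))%:E)%E}.
  move=> b01 ba int_b; have /andP[b_gt0 _] := b01.
  apply: filterS2 pointwise
    (ae_emp_tail_powR_dominated Xs_indep Xs_distr b01 mD int_b) => w cvgw [g ig Qg].
  apply: (cvg_integral_entropy_dominated mD a_gt0 (mFs^~ w) (fun n => Fs01 n w)
    mF cvgw b_gt0 ba ig).
  by move=> n x Dx; rewrite emp_distr_fun_tail subKr; exact: Qg.
have [b0a|ab0] := leP b0 a; first by apply: (dominated b0) => //; rewrite b0_gt0.
have [phi_oo|phi_fin] := eqVneq
    (\int[mu]_(x in D) (entropy_fun a (distr_fun X x))%:E)%E +oo%E.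
  apply: filterS pointwise => w cvgw.
  exact: (cvg_integral_entropy_pinfty mD a_gt0 (mFs^~ w) (fun n => Fs01 n w)).
have a1 : a < 1 by exact: lt_trans ab0 _.
(* There remains the case a < b0 with finite entropy. Integrability of the tail to the power a
   follows from the entropy integrand where F >= 1/2 and from the tail to the power b0 elsewhere. *)
apply: (dominated a) => //; first by rewrite a_gt0.
have mphi : measurable_fun D (fun x => (entropy_fun a (distr_fun X x))%:E).
  exact: measurable_entropy_fun.
have phi0 x : (0 <= (entropy_fun a (distr_fun X x))%:E)%E.
  by rewrite lee_fin entropy_fun_ge0//; have /andP[] := F01 x.
(* Where F < 1/2 the tail exceeds 1/2, so tail^a <= 1 <= 2 tail. *)
apply: (@le_lt_trans _ _ (\int[mu]_(x in D)
    (2%:E * (entropy_fun a (distr_fun X x))%:E + 2%:E * (tail X x `^ b0)%:E))%E).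
  apply: ge0_le_integral => //.
  - by move=> x _; rewrite lee_fin powR_ge0.
  - exact: measurable_funTS.
  - apply: emeasurable_funD; apply: emeasurable_funM => //.
    exact: measurable_funTS.
  - move=> x _; rewrite -!EFinM -EFinD lee_fin.
    have /andP[F0 F1] := F01 x; have /andP[q0 q1] := tail_01 X x.
    have [Fx|Fx] := leP 2^-1 (distr_fun X x).
      apply: (@le_trans _ _ (2 * entropy_fun a (distr_fun X x))).
        by apply: powR_onem_le_entropy_fun; [exact: ltW|rewrite Fx].
      by rewrite lerDl mulr_ge0 ?powR_ge0.
    apply: (@le_trans _ _ (2 * tail X x `^ b0)); last first.
      by rewrite lerDr mulr_ge0// entropy_fun_ge0.
    apply: (@le_trans _ _ (2 * tail X x)); last by rewrite ler_wpM2l.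
    apply: (@le_trans _ _ 1); last by rewrite /tail; lra.
    rewrite -[leRHS](one_powR a).
    by apply: ge0_ler_powR; rewrite ?nnegrE// ltW.
rewrite ge0_integralD//; last 4 first.
- by move=> x _; rewrite mule_ge0.
- exact: emeasurable_funM.
- by move=> x _; rewrite mule_ge0// lee_fin powR_ge0.
- by apply: emeasurable_funM => //; exact: measurable_funTS.
rewrite !ge0_integralZl_EFin//; last 2 first.
- by move=> x _; rewrite lee_fin powR_ge0.
- exact: measurable_funTS.
rewrite lte_add_pinfty ?lte_mul_pinfty//.
by rewrite ltey.
Qed.
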